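(* Let $N$ be a finite set of items with sizes $s(i)>0$, let $f:2^N\to\mathbb{R}_{\ge0}$ be normalized, monotone and submodular with $f(\{j\})>0$ for all $j$ and curvature $c\in(0,1]$, and let $\gamma>0$ be a capacity. Let $\mathrm{AG}$ be the output of AGreedy and $\mathrm{Opt}$ an optimal solution for capacity $\gamma$. Then $$f(\mathrm{AG})\ge\frac{1-x}{2-(2-c)x}\,f(\mathrm{Opt}),$$ where $x$ is the unique root of $\frac{1}{c}\bigl(1-e^{-cz}\bigr)=\frac{1-z}{2-(2-c)z}$ for $z\in[0,1]$.
   Context: $s(A)=\sum_{i\in A}s(i)$. $f$ normalized: $f(\emptyset)=0$; monotone: $f(A)\le f(B)$ for $A\subseteq B$; submodular: $f(A)+f(B)\ge f(A\cup B)+f(A\cap B)$. Curvature: $c=1-\min_{j\in N}\frac{f(N)-f(N\setminus\{j\})}{f(\{j\})}$. $\mathrm{Opt}$ maximizes $f(S)$ over $S\subseteq N$ with $s(S)\le\gamma$. AGreedy with capacity $\gamma$: let $N_\gamma=\{i: s(i)\le\gamma\}$, $n_\gamma=|N_\gamma|$; $G_0=\emptyset$, and for $j=1,\dots,n_\gamma$, $i_j$ maximizes $\frac{f(G_{j-1}\cup\{i\})-f(G_{j-1})}{s(i)}$ over $i\in N_\gamma\setminus G_{j-1}$, $G_j=G_{j-1}\cup\{i_j\}$. Let $k$ be the largest index with $s(G_k)\le\gamma$. If $k=n_\gamma$ return $G_k$; otherwise return $G_k$ if $f(G_k)\ge f(G_k\cup\{i_{k+1}\})-f(G_k)$, else return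 $\{i_{k+1}\}$. *)

(* Defs.v *)
From mathcomp Require Import all_boot all_order all_algebra.
From mathcomp Require Import reals sequences exp.

Set Implicit Arguments.
Unset Strict Implicit.
Unset Printing Implicit Defensive.

Import Order.TTheory GRing.Theory Num.Theory.
Local Open Scope ring_scope.

Section SetFunctions.
Variables (R : realType) (N : finType).
Implicit Types (f : {set N} -> R) (s : N -> R) (c gamma : R) (A B G : {set N}).

Definition set_normalized f : Prop := f set0 = 0.

Definition set_monotone f : Prop := forall A B, A \subset B -> f A <= f B.

Definition set_submodular f : Prop :=
  forall A B, f (A :|: B) + f (A :&: B) <= f A + f B.

Definition curvature_ratio f (j : N) : R :=
  (f [set: N] - f ([set: N] :\ j)) / f [set j].

(* The minimum over an empty ground set is undefined, so that no [c] is a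
   curvature when [N] is empty. *)
Definition is_curvature f c : Prop :=
  exists2 j, c = 1 - curvature_ratio f j
           & forall i, curvature_ratio f j <= curvature_ratio f i.

Definition total_size s A : R := \sum_(i in A) s i.

Definition is_optimal f s gamma A : Prop :=
  total_size s A <= gamma /\
  forall B, total_size s B <= gamma -> f B <= f A.

Definition fitting s gamma : {set N} := [set i | s i <= gamma].

Definition density f s G (i : N) : R := (f (i |: G) - f G) / s i.

Definition prefix_set (t : seq N) (j : nat) : {set N} := [set i in take j t].

(* [tnth t j] is the item selected in step [j + 1], and [prefix_set t j] the set
   of the first [j] selected items. Ties may be broken arbitrarily. *)
Definition greedy_order f s gamma (t : #|fitting s gamma|.-tuple N) : Prop :=
  forall j : 'I_#|fitting s gamma|,
    tnth t j \in fitting s gamma :\: prefix_set t j /\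
    forall i, i \in fitting s gamma :\: prefix_set t j ->
      density f s (prefix_set t j) i <= density f s (prefix_set t j) (tnth t j).

Definition last_feasible s gamma (t : seq N) : nat :=
  (\max_(j < (size t).+1 | (total_size s (prefix_set t j) <= gamma)%R) j)%N.

(* [onth t k] is the [(k + 1)]-st selected item; it is [None] exactly when [k]
   is the length of [t]. *)
Definition agreedy_choice f s gamma (t : seq N) : {set N} :=
  let k := last_feasible s gamma t in
  let G := prefix_set t k in
  if onth t k is Some i then
    if f (i |: G) - f G <= f G then G else [set i]
  else G.

Definition is_agreedy_output f s gamma A : Prop :=
  exists2 t : #|fitting s gamma|.-tuple N,
    greedy_order f t & A = agreedy_choice f s gamma t.

End SetFunctions.

Definition is_ratio_root (R : realType) (c z : R) : Prop :=
  0 <= z <= 1 /\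
  1 / c * (1 - expR (- (c * z))) = (1 - z) / (2 - (2 - c) * z).

(* Main.v *)
(* Let v be the value of the greedy prefix G, of size z gamma, at which the next
   item, of marginal value w, no longer fits, let d be the density of that item,
   and let V = f(Opt). Submodularity and the curvature give
     V + (1-c) f1(G \ Opt) <= v + d s(Opt \ G),
   where f1 sums the singleton values, and likewise for every shorter prefix.
   - Applied to all prefixes, this yields v >= V (1 - e^(-cz)) / c. Selecting
     an item of Opt lowers both the missing value and the remaining size of Opt;
     the bound survives because phi(q) = (1 - e^(-cq)) / c satisfies
     phi(q) + (1-q) phi'(q) <= 1 on [0, 1].
   - As items of G have singleton density at least d and the rejected item has
     size more than (1-z) gamma, it also yields
     (1-z) V <= (1-z) v + (1-z+cz) w, so max(v, w) is at least
     V (1-z) / (2 - (2-c) z).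
   The first bound increases with z, the second decreases, and they cross at the
   root x. *)

Require Import Defs.
From mathcomp Require Import all_boot all_order all_algebra.
From mathcomp Require Import reals sequences exp.
From mathcomp Require Import topology normedtype ring lra.
(* Imported again so that the set lemmas are about finite, not classical, sets. *)
From mathcomp Require Import finset.

Import Order.TTheory GRing.Theory Num.Theory.
Import numFieldNormedType.Exports.
Local Open Scope ring_scope.

(** * The function phi(q) = (1 - e^(-cq)) / c and the root equation *)

Section RatioFunction.
Context {R : realType}.
Implicit Types c q m r s t U z : R.

Definition exp_ratio c q : R := (1 - expR (- (c * q))) / c.

Lemma exp_ratio0 c : exp_ratio c 0 = 0.
Proof. by rewrite /exp_ratio mulr0 oppr0 expR0 subrr mul0r. Qed.

Lemma exp_ratio_le_id c q : 0 < c -> exp_ratio c q <= q.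
Proof.
move=> c0; rewrite ler_pdivrMr//.
have := expR_ge1Dx (- (c * q)); lra.
Qed.

Lemma ler_exp_ratio c : 0 < c -> {homo exp_ratio c : q z / q <= z}.
Proof.
move=> c0 q z qz; rewrite ler_pM2r ?invr_gt0// lerB// ler_expR lerN2.
by rewrite ler_pM2l.
Qed.

Lemma ltr_exp_ratio c : 0 < c -> {homo exp_ratio c : q z / q < z}.
Proof.
move=> c0 q z qz; rewrite ltr_pM2r ?invr_gt0// ltrD2l ltrN2 ltr_expR ltrN2.
by rewrite ltr_pM2l.
Qed.

(** The right side is the tangent of [exp_ratio c] at [q]; this form of concavity comes down to
    e^(-cz) >= 1 - cz. *)
Lemma exp_ratioD c q z : 0 < c ->
  exp_ratio c (q + z) <= exp_ratio c q + z * expR (- (c * q)).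
Proof.
move=> c0; rewrite /exp_ratio mulrDr opprD expRD.
set e := expR (- (c * q)).
rewrite -subr_ge0.
have -> : (1 - e) / c + z * e - (1 - e * expR (- (c * z))) / c
  = e * (expR (- (c * z)) - (1 - c * z)) / c by field; lra.
rewrite divr_ge0 ?(ltW c0)// mulr_ge0 ?expR_ge0//.
have := expR_ge1Dx (- (c * z)); lra.
Qed.

Lemma exp_ratio_tangent_le1 c q : 0 < c <= 1 -> 0 <= q <= 1 ->
  exp_ratio c q + (1 - q) * expR (- (c * q)) <= 1.
Proof.
move=> /andP[c0 c1] /andP[q0 q1].
set e := expR _.
have e1 : 1 - c * q <= e by have := expR_ge1Dx (- (c * q)).
rewrite /exp_ratio -/e -subr_ge0.
(* Times [c], the gap is affine in [e] with slope [1 - c + c * q >= 0]; at the lower bound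
   [e = 1 - c * q] it equals c^2 q (1 - q). *)
have -> : 1 - ((1 - e) / c + (1 - q) * e) =
  ((e - (1 - c * q)) * (1 - c + c * q) + c ^+ 2 * (q * (1 - q))) / c.
  by field; lra.
rewrite divr_ge0 ?(ltW c0)// addr_ge0// mulr_ge0 ?sqr_ge0//; first lra.
- have : 0 <= c * q by rewrite mulr_ge0 // ltW.
  lra.
- by rewrite mulr_ge0 ?subr_ge0.
Qed.

Lemma exp_ratio_le1 c q : 0 < c <= 1 -> q <= 1 -> exp_ratio c q <= 1.
Proof. by case/andP=> c0 _; apply/le_trans/exp_ratio_le_id. Qed.

(* One greedy step of size [s] and gain [m], for an item outside the optimum:
   [U] is the value still missing, [r] the size of the optimum not yet selected
   and [t] the size still to be filled. *)
Lemma exp_ratio_step_outside c m r s t U : 0 < c -> 0 <= m -> 0 < r -> 0 <= s ->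
  s * U <= m * r ->
  U * exp_ratio c (t / r) <= m + (U - c * m) * exp_ratio c ((t - s) / r).
Proof.
move=> c0 m0 r0 s0 sU.
set q := (t - s) / r.
have -> : t / r = q + s / r by rewrite /q; field; lra.
have e0 : 0 < expR (- (c * q)) by exact: expR_gt0.
have -> : m + (U - c * m) * exp_ratio c q =
   U * exp_ratio c q + m * expR (- (c * q)) by rewrite /exp_ratio; field; lra.
(* A negative [U] reverses the tangent bound; there monotonicity of [exp_ratio] suffices. *)
have [U0|U0] := leP 0 U.
  have : U * exp_ratio c (q + s / r) <=
         U * (exp_ratio c q + s / r * expR (- (c * q))).
    by rewrite ler_wpM2l// exp_ratioD.
  move/le_trans; apply; rewrite mulrDr lerD2l mulrA ler_pM2r//.
  by rewrite mulrA ler_pdivrMr// mulrC.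
have : U * exp_ratio c (q + s / r) <= U * exp_ratio c q.
  by rewrite ler_nM2l// ler_exp_ratio// lerDl divr_ge0// ltW.
move/le_trans; apply; rewrite lerDl mulr_ge0//; exact: ltW.
Qed.

(* The same step for an item of the optimum. When [s = r] the new fill fraction
   is [0 / 0 = 0], which is the right value since then [t - s = 0]. *)
Lemma exp_ratio_step_inside c m r s t U : 0 < c <= 1 -> 0 <= m -> 0 < s <= t ->
  t <= r -> s * U <= m * r ->
  U * exp_ratio c (t / r) <= m + (U - m) * exp_ratio c ((t - s) / (r - s)).
Proof.
move=> c01 m0 /andP[s0 st] tr sU.
have /andP[c0 c1] := c01.
have r0 : 0 < r by lra.
set q := (t - s) / (r - s).
have q01 : 0 <= q <= 1.
  rewrite /q divr_ge0 ?subr_ge0//=; last lra.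
  have [->|nrs] := eqVneq r s; first by rewrite subrr invr0 mulr0 ler01.
  have sr : 0 < r - s by rewrite subr_gt0 lt_neqAle eq_sym nrs; lra.
  rewrite ler_pdivrMr//; lra.
have /andP[q0 q1] := q01.
(* The old fill fraction lies the fraction [s / r] of the way from [q] to 1, so the tangent at [q],
   evaluated at 1, controls the step. *)
have qE : t / r = q + s / r * (1 - q).
  have [rs|nrs] := eqVneq r s.
    have ts : t = s by lra.
    rewrite /q ts rs !subrr mul0r add0r subr0 mulr1//.
  by rewrite /q; field; rewrite subr_eq0 nrs gt_eqF.
have q1' := exp_ratio_le1 c q c01 q1.
have [U0|U0] := leP 0 U.
  have sr0 : 0 <= s / r by rewrite divr_ge0 // ltW.
  have H1 : exp_ratio c (t / r) <= exp_ratio c q + s / r * (1 - exp_ratio c q).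
    rewrite qE; apply: le_trans (exp_ratioD _ _ _ c0) _.
    rewrite lerD2l -mulrA ler_wpM2l//.
    have := exp_ratio_tangent_le1 c q c01 q01; lra.
  have H2 : U * (s / r) <= m by rewrite mulrA ler_pdivrMr// mulrC.
  have := ler_wpM2l U0 H1.
  have : 0 <= (m - U * (s / r)) * (1 - exp_ratio c q).
    by rewrite mulr_ge0 ?subr_ge0.
  lra.
have H : U * exp_ratio c (t / r) <= U * exp_ratio c q.
  rewrite ler_nM2l// ler_exp_ratio// qE lerDl mulr_ge0 ?subr_ge0//.
  by rewrite divr_ge0 // ltW.
have : 0 <= m * (1 - exp_ratio c q) by rewrite mulr_ge0 ?subr_ge0.
lra.
Qed.

Definition greedy_ratio c z : R := (1 - z) / (2 - (2 - c) * z).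

Lemma greedy_ratio_den_gt0 c z : 0 < c <= 1 -> 0 <= z <= 1 ->
  0 < 2 - (2 - c) * z.
Proof. move=> /andP[c0 c1] /andP[z0 z1]; nra. Qed.

Lemma greedy_ratio_decr c z y : 0 < c <= 1 -> 0 <= z <= 1 -> 0 <= y <= 1 ->
  z < y -> greedy_ratio c y < greedy_ratio c z.
Proof.
move=> c01 z01 y01 zy.
have z0 := greedy_ratio_den_gt0 _ _ c01 z01.
have y0 := greedy_ratio_den_gt0 _ _ c01 y01.
rewrite /greedy_ratio ltr_pdivrMr// mulrAC ltr_pdivlMr//.
(* Cross-multiplied, the gap is [c * (y - z)]. *)
case/andP: c01; nra.
Qed.

Lemma is_ratio_rootE c z :
  is_ratio_root c z <-> 0 <= z <= 1 /\ exp_ratio c z = greedy_ratio c z.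
Proof. by rewrite /is_ratio_root div1r mulrC. Qed.

Lemma ratio_root_inj c z y : 0 < c <= 1 ->
  is_ratio_root c z -> is_ratio_root c y -> z = y.
Proof.
move=> c01 /is_ratio_rootE[z01 zE] /is_ratio_rootE[y01 yE].
have /andP[c0 _] := c01.
have [zy|yz|//] := ltgtP z y.
  have := greedy_ratio_decr _ _ _ c01 z01 y01 zy.
  by rewrite -zE -yE => /(lt_trans (ltr_exp_ratio c c0 z y zy)); rewrite ltxx.
have := greedy_ratio_decr _ _ _ c01 y01 z01 yz.
by rewrite -zE -yE => /(lt_trans (ltr_exp_ratio c c0 y z yz)); rewrite ltxx.
Qed.

Lemma ratio_root_exists c : 0 < c <= 1 -> exists z, is_ratio_root c z.
Proof.
move=> c01; have /andP[c0 c1] := c01.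
(* The difference of the two sides, cleared of denominators so that continuity is immediate. *)
pose h z : R := (1 - expR (- (c * z))) * (2 - (2 - c) * z) - c * (1 - z).
have hC : continuous h.
  move=> z; apply: cvgB; apply: cvgM.
  - apply: cvgB; first exact: cvg_cst.
    apply: continuous_comp; last exact: continuous_expR.
    by apply: continuousN; exact: mulrl_continuous.
  - by apply: cvgB; [exact: cvg_cst|exact: mulrl_continuous].
  - exact: cvg_cst.
  - by apply: cvgB; [exact: cvg_cst|exact: cvg_id].
have h0 : h 0 < 0 by rewrite /h mulr0 oppr0 expR0; lra.
have h1 : 0 < h 1.
  rewrite /h !mulr1 subrr mulr0 subr0 mulr_gt0 //; last lra.
  by rewrite subr_gt0 expR_lt1 oppr_lt0.
have [|z + hz] := @IVT R h 0 1 0 ler01 (continuous_subspaceT hC).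
  by rewrite ge_min le_max (ltW h0) (ltW h1) orbT.
rewrite in_itv/= => z01; exists z; apply/is_ratio_rootE; split=> //.
have z0 := greedy_ratio_den_gt0 _ _ c01 z01.
rewrite /exp_ratio /greedy_ratio; apply/eqP.
rewrite eqr_div ?lt0r_neq0// -subr_eq0 -hz /h; apply/eqP; ring.
Qed.

End RatioFunction.

(** * Submodularity and curvature, by induction on finite sets *)

Lemma set_insert_ind (T : finType) (P : {set T} -> Prop) : P set0 ->
  (forall x (A : {set T}), x \notin A -> P A -> P (x |: A)) -> forall A, P A.
Proof.
move=> P0 PS A; have [n] := ubnP #|A|; elim: n A => // n IH A An.
have [->//|/set0Pn[x xA]] := eqVneq A set0.
rewrite -(setD1K xA); apply: PS; first by rewrite !inE eqxx.
by apply: IH; rewrite (cardsD1 x A) xA in An.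
Qed.

Section SetFunctionBounds.
Context {R : realType} {N : finType} (f : {set N} -> R).
Hypotheses (f_monotone : set_monotone f) (f_submodular : set_submodular f).
Implicit Types (A B G S : {set N}) (i : N) (s : N -> R).

(** Submodularity is applied to [i |: A] and [B]. Their intersection can exceed [A] when [i \in B];
    monotonicity absorbs that case. *)
Lemma marginal_antitone A B i : A \subset B ->
  f (i |: B) - f B <= f (i |: A) - f A.
Proof.
move=> AB; have := f_submodular (i |: A) B.
rewrite -setUA (setUidPr AB).
have : f A <= f ((i |: A) :&: B) by rewrite f_monotone// subsetI subsetUr.
lra.
Qed.

Lemma union_le_sum_marginals G B :
  f (G :|: B) <= f G + \sum_(i in B) (f (i |: G) - f G).
Proof.
elim/set_insert_ind: B => [|i B iB IH]; first by rewrite big_set0 setU0 addr0.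
rewrite big_setU1//= setUCA.
have := marginal_antitone G (G :|: B) i (subsetUl _ _); lra.
Qed.

(** By diminishing returns, an item contributes least when it is added after all others. *)
Lemma sum_residual_marginals_le A B : B \subset ~: A ->
  f A + \sum_(i in B) (f [set: N] - f ([set: N] :\ i)) <= f (A :|: B).
Proof.
elim/set_insert_ind: B => [|i B iB IH]; first by rewrite big_set0 setU0 addr0.
rewrite subUset sub1set inE => /andP[iA /IH {}IH].
rewrite big_setU1//= setUCA.
have := marginal_antitone (A :|: B) ([set: N] :\ i) i.
rewrite subsetD1 subsetT in_setU negb_or iA iB setD1K ?in_setT//= => /(_ isT).
lra.
Qed.

Lemma curvature_residual c i : is_curvature f c -> 0 < f [set i] ->
  (1 - c) * f [set i] <= f [set: N] - f ([set: N] :\ i).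
Proof.
by case=> j -> jmin fi; rewrite subKr -ler_pdivlMr//; exact: jmin.
Qed.

(** The value of the union of [S] and [G] is estimated twice: from below by adding [G :\: S] to [S],
    using the curvature, and from above by adding [S :\: G] to [G]. *)
Lemma opt_le_curvature_bound c s G S (d : R) : is_curvature f c ->
  (forall i, 0 < f [set i]) ->
  (forall i, i \in S :\: G -> f (i |: G) - f G <= d * s i) ->
  f S + (1 - c) * \sum_(i in G :\: S) f [set i] <=
  f G + d * total_size s (S :\: G).
Proof.
move=> fc f1 Hd.
have lb := @sum_residual_marginals_le S (G :\: S).
have ub := union_le_sum_marginals G (S :\: G).
have SG : S :|: G :\: S = G :|: S :\: G.
  by apply/setP=> x; rewrite !inE; case: (x \in S); case: (x \in G).
rewrite mulr_sumr /total_size mulr_sumr.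
have : \sum_(i in S :\: G) (f (i |: G) - f G) <= \sum_(i in S :\: G) d * s i.
  exact: ler_sum.
have : \sum_(i in G :\: S) (1 - c) * f [set i] <=
       \sum_(i in G :\: S) (f [set: N] - f ([set: N] :\ i)).
  by apply: ler_sum => i _; exact: curvature_residual.
have dSG : G :\: S \subset ~: S by rewrite setDE subsetIr.
have := lb dSG; rewrite SG.
lra.
Qed.

End SetFunctionBounds.

(** * Sizes, prefixes and the last feasible prefix *)

Section Sizes.
Context {R : realType} {N : finType} (s : N -> R).
Hypothesis s_gt0 : forall i, 0 < s i.
Implicit Types (A B G : {set N}) (i : N) (t : seq N).

Lemma total_size_setU1 A i : i \notin A ->
  total_size s (i |: A) = s i + total_size s A.
Proof. by move=> iA; rewrite /total_size big_setU1. Qed.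

Lemma total_size_setID A B :
  total_size s A = total_size s (A :&: B) + total_size s (A :\: B).
Proof. by rewrite /total_size (big_setID B). Qed.

Lemma total_size_ge0 A : 0 <= total_size s A.
Proof. by apply: sumr_ge0 => i _; exact: ltW. Qed.

Lemma ler_total_size A B : A \subset B -> total_size s A <= total_size s B.
Proof.
move=> AB; rewrite (total_size_setID B A) (setIidPr AB) lerDl.
exact: total_size_ge0.
Qed.

Lemma subset_fitting gamma A : total_size s A <= gamma ->
  A \subset fitting s gamma.
Proof.
move=> Ag; apply/subsetP => i iA; rewrite inE; apply: le_trans Ag.
have : [set i] \subset A by rewrite sub1set.
by move/ler_total_size; rewrite /total_size big_set1.
Qed.

Lemma prefix_set0 t : prefix_set t 0 = set0.
Proof. by rewrite /prefix_set take0 set_nil. Qed.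

Lemma prefix_setS t j x0 : (j < size t)%N ->
  prefix_set t j.+1 = nth x0 t j |: prefix_set t j.
Proof.
move=> jt; apply/setP => x.
by rewrite /prefix_set (take_nth x0)// !inE mem_rcons inE.
Qed.

Lemma subset_prefix_set t j k : (j <= k)%N ->
  prefix_set t j \subset prefix_set t k.
Proof.
by move=> jk; apply/subsetP => x; rewrite !inE -(subnK jk) addnC takeD mem_cat => ->.
Qed.

Lemma last_feasible_le_size gamma t : (last_feasible s gamma t <= size t)%N.
Proof. by apply/bigmax_leqP => j _; rewrite -ltnS. Qed.

Lemma last_feasibleP gamma t : 0 <= gamma ->
  total_size s (prefix_set t (last_feasible s gamma t)) <= gamma.
Proof.
move=> g0; rewrite /last_feasible.
have [|j jP ->] := @eq_bigmax_cond _
   (mem [pred j : 'I_(size t).+1 | total_size s (prefix_set t j) <= gamma])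
   (fun j => j : nat).
  (* The empty prefix is feasible, so the maximum is attained. *)
  apply/card_gt0P; exists ord0.
  change (total_size s (prefix_set t 0) <= gamma).
  by rewrite prefix_set0 /total_size big_set0.
exact: jP.
Qed.

Lemma last_feasible_next gamma t :
  (last_feasible s gamma t < size t)%N ->
  gamma < total_size s (prefix_set t (last_feasible s gamma t).+1).
Proof.
move=> kt; rewrite ltNge; apply/negP => le.
have kt' : ((last_feasible s gamma t).+1 < (size t).+1)%N by [].
have := @leq_bigmax_cond _
   (fun j : 'I_(size t).+1 => total_size s (prefix_set t j) <= gamma)
   (fun j => j : nat) (Ordinal kt') le.
by rewrite /= -/(last_feasible s gamma t) ltnn.
Qed.

End Sizes.

(** * The greedy order compared with a feasible set [S] *)

Section Greedy.
Context {R : realType} {N : finType} (s : N -> R) (f : {set N} -> R).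
Context (c gamma : R).
Hypothesis s_gt0 : forall i, 0 < s i.
Hypothesis f_ge0 : forall A, 0 <= f A.
Hypothesis f_normalized : set_normalized f.
Hypothesis f_monotone : set_monotone f.
Hypothesis f_submodular : set_submodular f.
Hypothesis f1_gt0 : forall j, 0 < f [set j].
Hypothesis c_curvature : is_curvature f c.
Hypothesis c01 : 0 < c <= 1.
Hypothesis gamma_gt0 : 0 < gamma.
Variable t : #|fitting s gamma|.-tuple N.
Hypothesis t_greedy : greedy_order f t.
Variable x0 : N.
Implicit Types (j k : nat) (S : {set N}).

Let G j : {set N} := prefix_set t j.
Let item j : N := nth x0 t j.
Let gain j : R := f (item j |: G j) - f (G j).

Lemma greedy_item j : (j < size t)%N ->
  [/\ item j \in fitting s gamma, item j \notin G j &
    forall i, i \in fitting s gamma -> i \notin G j ->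
      density f s (G j) i <= gain j / s (item j)].
Proof.
rewrite size_tuple => jt; have [] := t_greedy (Ordinal jt).
rewrite !(tnth_nth x0)/= inE => /andP[iG ifit] H; split=> // i fi Gi.
by apply: H; rewrite inE Gi.
Qed.

Lemma greedy_prefixS j : (j < size t)%N -> G j.+1 = item j |: G j.
Proof. exact: prefix_setS. Qed.

Lemma gain_ge0 j : 0 <= gain j.
Proof. by rewrite subr_ge0 f_monotone// subsetUr. Qed.

Lemma gain_le1 j : gain j <= f [set item j].
Proof.
have := marginal_antitone _ f_monotone f_submodular _ _ (item j) (sub0set (G j)).
by rewrite setU0 f_normalized subr0.
Qed.

(** Each item of a feasible [S] fits on its own, so those outside [G j] competed with [item j] and
    have at most its density. *)
Lemma greedy_opt_bound j S : (j < size t)%N -> total_size s S <= gamma ->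
  f S + (1 - c) * \sum_(i in G j :\: S) f [set i] <=
  f (G j) + gain j / s (item j) * total_size s (S :\: G j).
Proof.
move=> jt Sg; have [_ _ gr] := greedy_item _ jt.
apply: opt_le_curvature_bound => // i; rewrite inE => /andP[iG iS].
rewrite -ler_pdivrMr//; apply: gr => //.
by have /subsetP := subset_fitting s s_gt0 _ _ Sg; exact.
Qed.

(* [M] stands for the total gain of the selected items outside [S]. *)
Lemma greedy_invariant T S j : T <= gamma -> total_size s S <= gamma ->
  (j <= size t)%N -> total_size s (G j) <= T ->
  exists2 M : R, M <= \sum_(i in G j :\: S) f [set i] &
    f S * exp_ratio c (T / gamma) <= f (G j) +
      (f S - f (G j) + (1 - c) * M) *
        exp_ratio c ((T - total_size s (G j)) / (gamma - total_size s (S :&: G j))).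
Proof.
have /andP[c0 c1] := c01.
move=> Tg Sg; elim: j => [_ _|j IH jt GT].
  exists 0; rewrite /G prefix_set0; first by rewrite set0D big_set0.
  by rewrite setI0 /total_size big_set0 f_normalized mulr0 !subr0 add0r addr0.
have [_ iG _] := greedy_item _ jt.
have sG' : total_size s (G j.+1) = s (item j) + total_size s (G j).
  by rewrite greedy_prefixS// total_size_setU1.
have si := s_gt0 (item j).
have [|M MG HM] := IH (ltnW jt); first by rewrite sG' in GT; lra.
have Gm : f (G j.+1) = f (G j) + gain j.
  by rewrite greedy_prefixS// addrC subrK.
have m0 := gain_ge0 j.
set U := f S - f (G j) + (1 - c) * M in HM.
set r := gamma - total_size s (S :&: G j) in HM.
have tr : T - total_size s (G j) <= r.
  have := ler_total_size s s_gt0 _ _ (subsetIr S (G j)); rewrite /r; lra.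
(* The density of [item j] is at least [U / r]: the unselected part of [S] has size at most [r], and
   [M] is at most the sum of singleton values in [greedy_opt_bound]. *)
have sUm : s (item j) * U <= gain j * r.
  have H := greedy_opt_bound _ _ jt Sg.
  have cM : (1 - c) * M <= (1 - c) * \sum_(i in G j :\: S) f [set i].
    by rewrite ler_wpM2l// subr_ge0.
  have Sr : total_size s (S :\: G j) <= r.
    by have := total_size_setID s S (G j); rewrite /r; lra.
  have Ud : U <= gain j / s (item j) * total_size s (S :\: G j).
    by rewrite /U; lra.
  have : U <= gain j / s (item j) * r.
    by apply: le_trans Ud _; rewrite ler_wpM2l// divr_ge0// ltW.
  by rewrite mulrAC ler_pdivlMr// mulrC.
have iT : 0 < s (item j) <= T - total_size s (G j) by rewrite si; lra.
have [iS|iS] := boolP (item j \in S).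
  (* For an item of [S], [M] stays, [U] drops by the gain and [r] by the size. *)
  exists M.
    suff -> : G j.+1 :\: S = G j :\: S by [].
    rewrite greedy_prefixS//; apply/setP => x; rewrite !inE.
    by have [->|//] := eqVneq x (item j); rewrite iS.
  have -> : total_size s (S :&: G j.+1) = s (item j) + total_size s (S :&: G j).
    rewrite greedy_prefixS// -total_size_setU1 ?in_setI ?(negPf iG) ?andbF//.
    congr total_size; apply/setP => x; rewrite !inE.
    by have [->|] := eqVneq x (item j); rewrite ?iS.
  have := exp_ratio_step_inside _ _ _ _ _ _ c01 m0 iT tr sUm.
  rewrite sG' Gm.
  have -> : f S - (f (G j) + gain j) + (1 - c) * M = U - gain j.
    by rewrite /U; ring.
  have -> : T - (s (item j) + total_size s (G j)) =
            T - total_size s (G j) - s (item j) by ring.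
  have -> : gamma - (s (item j) + total_size s (S :&: G j)) = r - s (item j).
    by rewrite /r; ring.
  by move=> H; apply: le_trans HM _; rewrite -[leRHS]addrA lerD2l.
(* For an item outside [S], [M] grows by the gain, so [U] drops by only [c * gain j], while [r]
   stays. *)
exists (gain j + M).
  have -> : G j.+1 :\: S = item j |: (G j :\: S).
    rewrite greedy_prefixS//; apply/setP => x; rewrite !inE.
    by have [->|//] := eqVneq x (item j); rewrite iS.
  by rewrite big_setU1 ?in_setD ?(negPf iG) ?andbF//= lerD// gain_le1.
have -> : S :&: G j.+1 = S :&: G j.
  rewrite greedy_prefixS//; apply/setP => x; rewrite !inE.
  by have [->|//] := eqVneq x (item j); rewrite (negPf iS).
have r0 : 0 < r by case/andP: iT; lra.
have := exp_ratio_step_outside _ _ _ _ _ _ c0 m0 r0 (ltW si) sUm.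
rewrite sG' Gm.
have -> : f S - (f (G j) + gain j) + (1 - c) * (gain j + M) = U - c * gain j.
  by rewrite /U; ring.
have -> : T - (s (item j) + total_size s (G j)) =
          T - total_size s (G j) - s (item j) by ring.
by move=> H; apply: le_trans HM _; rewrite -[leRHS]addrA lerD2l.
Qed.

(** With [T] the size of [G j] nothing is left to fill, so the last term of the invariant vanishes,
    even over a zero denominator. *)
Lemma greedy_exp_bound S j : total_size s S <= gamma -> (j <= size t)%N ->
  total_size s (G j) <= gamma ->
  f S * exp_ratio c (total_size s (G j) / gamma) <= f (G j).
Proof.
move=> Sg jt Gg.
have [M _] := greedy_invariant _ _ _ Gg Sg jt (lexx _).
by rewrite subrr mul0r exp_ratio0 mulr0 addr0.
Qed.

(** When [l] was selected, [item j] was still available, with a marginal value at least its present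
    one. *)
Lemma greedy_density_le j l : (j < size t)%N -> l \in G j ->
  gain j / s (item j) * s l <= f [set l].
Proof.
move=> jt lG.
have lt : l \in take j t by move: lG; rewrite inE.
have ij : (index l t < j)%N by exact: index_ltn.
have it := ltn_trans ij jt.
have lE : item (index l t) = l.
  by rewrite /item nth_index//; apply: mem_take lt.
have [ifit iG _] := greedy_item _ jt.
have GG : G (index l t) \subset G j by apply: subset_prefix_set; exact: ltnW.
have [_ _ /(_ (item j) ifit)] := greedy_item _ it.
rewrite (contra (subsetP GG _))// => /(_ isT).
rewrite -[X in _ <= X / _]/(gain (index l t)) lE => H.
rewrite -ler_pdivlMr//.
apply: le_trans (le_trans _ H) _.
  rewrite /density ler_pM2r ?invr_gt0//.
  exact: marginal_antitone.
by rewrite ler_pM2r ?invr_gt0// -{2}lE gain_le1.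
Qed.

Lemma greedy_overflow_bound S j z : total_size s S <= gamma -> (j < size t)%N ->
  z * gamma = total_size s (G j) -> z <= 1 ->
  gamma <= s (item j) + total_size s (G j) ->
  (1 - z) * f S <= (1 - z) * f (G j) + (1 - z + c * z) * gain j.
Proof.
have /andP[c0 c1] := c01.
move=> Sg jt zE z1 over.
have := greedy_opt_bound _ _ jt Sg.
set d := gain j / s (item j).
have d0 : 0 <= d by rewrite divr_ge0 ?gain_ge0// ltW.
have : (1 - c) * (d * total_size s (G j :\: S)) <=
       (1 - c) * \sum_(i in G j :\: S) f [set i].
  rewrite ler_wpM2l ?subr_ge0// /total_size mulr_sumr ler_sum// => l.
  by rewrite inE => /andP[_ lG]; exact: greedy_density_le.
have GE := total_size_setID s (G j) S.
have SE := total_size_setID s S (G j).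
rewrite setIC in SE.
have a0 := total_size_ge0 s s_gt0 (G j :&: S).
set a := total_size s (G j :&: S) in GE SE a0.
set b := total_size s (G j :\: S) in GE *.
set e := total_size s (S :\: G j) in SE *.
have z0 : 0 <= z.
  by rewrite -(pmulr_lge0 _ gamma_gt0) zE; exact: total_size_ge0.
move=> H1 H2.
have H3 : d * e <= d * (gamma - a) by rewrite ler_wpM2l//; lra.
(* The overlap of [S] and [G j] only improves the bound, by [c * (d * a)]; disjointness is the worst
   case. *)
have ca : 0 <= c * (d * a) by apply: mulr_ge0 (ltW c0) (mulr_ge0 d0 a0).
have H4 : f S <= f (G j) + d * gamma * (1 - z + c * z).
  have -> : d * gamma * (1 - z + c * z) = d * gamma - (1 - c) * (d * (z * gamma)).
    by ring.
  by rewrite zE GE; lra.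
have H5 : d * gamma * (1 - z) <= gain j.
  have -> : gain j = d * s (item j) by rewrite divfK// gt_eqF.
  by rewrite -mulrA ler_wpM2l//; lra.
have cz : 0 <= 1 - z + c * z by rewrite addr_ge0 ?subr_ge0// mulr_ge0// ltW.
(* With [H5] scaled by [1 - z + c * z] and [H4] by [1 - z], the terms in [d * gamma] cancel without
   a division by [1 - z], which may be 0. *)
have := ler_wpM2r cz H5.
have z1' : 0 <= 1 - z by rewrite subr_ge0.
have := ler_wpM2l z1' H4.
lra.
Qed.

(** The selected items are distinct and fitting, and there are as many of them as fitting items. *)
Lemma fitting_subset_greedy : fitting s gamma \subset G (size t).
Proof.
have H j : (j <= size t)%N -> #|G j| = j /\ G j \subset fitting s gamma.
  elim: j => [_|j IH jt].
    by rewrite /G prefix_set0 cards0 sub0set.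
  have [cG Gf] := IH (ltnW jt); have [ifit iG _] := greedy_item _ jt.
  by rewrite greedy_prefixS// cardsU1 iG cG subUset sub1set ifit.
have [cG Gf] := H _ (leqnn _).
by move: (eqEcard (G (size t)) (fitting s gamma)); rewrite Gf cG size_tuple leqnn => /eqP ->.
Qed.

Lemma agreedy_choice_bound x S : is_ratio_root c x -> total_size s S <= gamma ->
  greedy_ratio c x * f S <= f (agreedy_choice f s gamma t).
Proof.
have /andP[c0 c1] := c01.
move=> /is_ratio_rootE[x01 xE] Sg; have /andP[x_ge0 x_le1] := x01.
have fS := f_ge0 S.
rewrite /agreedy_choice; set k := last_feasible s gamma t.
have kt : (k <= size t)%N := last_feasible_le_size s gamma t.
have Gg : total_size s (G k) <= gamma.
  by apply: last_feasibleP; exact: ltW.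
have ratio_le1 : greedy_ratio c x <= 1.
  rewrite /greedy_ratio ler_pdivrMr ?greedy_ratio_den_gt0//; nra.
(* If no item is rejected, the output contains every fitting item, hence all of [S]. *)
have [sk|kt'] := leqP (size t) k.
  rewrite onth_default//.
  have -> : k = size t by apply/eqP; rewrite eqn_leq kt.
  have : f S <= f (G (size t)).
    apply: f_monotone; apply: subset_trans fitting_subset_greedy.
    exact: subset_fitting Sg.
  by apply: le_trans; rewrite ler_piMl.
have := last_feasible_next s gamma t kt'.
rewrite -/k -/(G k.+1) greedy_prefixS//.
have [_ iG _] := greedy_item _ kt'.
rewrite total_size_setU1// => over.
have -> : onth t k = Some (item k).
  move: kt'; rewrite -onthTE; case E: (onth t k) => [y|//] _.
  by rewrite /item (onth_nth x0 _ _ _ E).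
rewrite -/(G k) -/(gain k).
(* Either branch of the choice reaches this maximum, since a singleton is worth at least its
   gain. *)
suff : greedy_ratio c x * f S <= Num.max (f (G k)) (gain k).
  rewrite le_max => Hmax.
  case: (leP (gain k) (f (G k))) => [wv|vw].
    by case/orP: Hmax => // H; exact: le_trans H wv.
  apply: le_trans (gain_le1 k).
  by case/orP: Hmax => // H; exact: le_trans H (ltW vw).
set m := Num.max _ _.
have Gm : f (G k) <= m by rewrite le_max lexx.
have gm : gain k <= m by rewrite le_max lexx orbT.
pose z := total_size s (G k) / gamma.
have zE : z * gamma = total_size s (G k) by rewrite divfK// gt_eqF.
have z1 : z <= 1 by rewrite ler_pdivrMr// mul1r.
have z0 : 0 <= z by rewrite divr_ge0 ?total_size_ge0// ltW.
have [xz|zx] := leP x z.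
  apply: le_trans Gm; apply: le_trans (greedy_exp_bound _ _ Sg kt Gg).
  by rewrite mulrC ler_wpM2l// -xE ler_exp_ratio.
have z01 : 0 <= z <= 1 by rewrite z0.
apply: (@le_trans _ _ (greedy_ratio c z * f S)).
  by rewrite ler_wpM2r// ltW// greedy_ratio_decr.
rewrite /greedy_ratio mulrAC ler_pdivrMr ?greedy_ratio_den_gt0//.
have H := greedy_overflow_bound _ _ _ Sg kt' zE z1 (ltW over).
(* The two weights [1 - z] and [1 - z + c * z] add up to the denominator [2 - (2 - c) * z]. *)
have cz : 0 <= 1 - z + c * z by rewrite addr_ge0 ?subr_ge0// mulr_ge0// ltW.
have z1' : 0 <= 1 - z by rewrite subr_ge0.
have := ler_wpM2l z1' Gm; have := ler_wpM2l cz gm; lra.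
Qed.

End Greedy.

Theorem theorem6 (R : realType) (N : finType) (s : N -> R)
    (f : {set N} -> R) (c gamma : R)
    (s_gt0 : forall i, 0 < s i)
    (f_ge0 : forall A, 0 <= f A)
    (f_normalized : set_normalized f)
    (f_monotone : set_monotone f)
    (f_submodular : set_submodular f)
    (f1_gt0 : forall j, 0 < f [set j])
    (c_curvature : is_curvature f c)
    (c_gt0 : 0 < c) (c_le1 : c <= 1)
    (gamma_gt0 : 0 < gamma) :
  exists x : R, unique (is_ratio_root c) x /\
    forall AG Opt : {set N},
      is_agreedy_output f s gamma AG -> is_optimal f s gamma Opt ->
      f AG >= (1 - x) / (2 - (2 - c) * x) * f Opt.
Proof.
have c01 : 0 < c <= 1 by rewrite c_gt0.
have [x xP] := ratio_root_exists _ c01; exists x; split.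
  by split=> // y; exact: ratio_root_inj.
(* The item attaining the curvature serves as the default of [nth]. *)
have [x0 _ _] := c_curvature.
move=> AG Opt [t t_greedy ->] [Optg _].
exact: agreedy_choice_bound xP Optg.
Qed.
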